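(* Let $(R,\mathfrak m)$ be a complete noetherian local integral domain with fraction field $Q$, and let $M$ and $N$ be finitely generated $R$-modules. Then $\operatorname{Ext}^1_R(M,N)$ is weakly cotorsion, i.e. $\operatorname{Ext}^1_R\bigl(Q,\operatorname{Ext}^1_R(M,N)\bigr)=0$.
   Context: For an integral domain $R$ with fraction field $Q$, an $R$-module $X$ is called weakly cotorsion if $\operatorname{Ext}^1_R(Q,X)=0$. *)

(* Defs.v *)
(* MathComp, with the classical axioms of mathcomp.classical.boolp: boolean
   predicates are therefore arbitrary predicates, and every type is a
   choiceType, so that [lmodType R] ranges over all R-modules. *)
From HB Require Import structures.
From mathcomp Require Import all_boot all_algebra.
From mathcomp Require Import generic_quotient ring_quotient fraction.
From mathcomp Require Import boolp freeg.

Set Implicit Arguments.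
Unset Strict Implicit.
Unset Printing Implicit Defensive.

Import GRing.Theory.
Local Open Scope ring_scope.
Local Open Scope quotient_scope.

Record submod (R : comNzRingType) (V : lmodType R) := Submod {
  submod_pred :> {pred V};
  submod_predP : submod_closed submod_pred
}.

Section SubmoduleQuotient.
Variables (R : comNzRingType) (V : lmodType R) (S : submod V).

HB.instance Definition _ := GRing.isSubmodClosed.Build R V (submod_pred S)
  (submod_predP S).

Record submodType := SubmodType {
  submod_val :> V;
  _ : submod_val \in submod_pred S
}.

HB.instance Definition _ := [isSub for submod_val].
HB.instance Definition _ := [Choice of submodType by <:].
HB.instance Definition _ := [SubChoice_isSubLmodule of submodType by <:].

(* The quotient module V / S.  The library construct is the quotient of the
   additive group V by S, despite the name of its notation. *)
Definition quotmod := {ideal_quot (submod_pred S)}.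

HB.instance Definition _ := EqQuotient.on quotmod.
HB.instance Definition _ := ZmodQuotient.on quotmod.

Definition quotmod_scale (a : R) : quotmod -> quotmod :=
  lift_op1 quotmod (fun x => a *: x).

Lemma pi_quotmod_scale (a : R) (x : V) :
  \pi_quotmod (a *: x) = quotmod_scale a (\pi_quotmod x).
Proof.
unlock quotmod_scale; apply/eqP.
rewrite -Quotient.idealrBE -scalerBr rpredZ //.
by rewrite Quotient.idealrBE reprK.
Qed.

Lemma quotmod_scaleA a b x :
  quotmod_scale a (quotmod_scale b x) = quotmod_scale (a * b) x.
Proof. by rewrite -[x]reprK -!pi_quotmod_scale scalerA. Qed.

Lemma quotmod_scale1 : left_id 1 quotmod_scale.
Proof. by move=> x; rewrite -[x]reprK -pi_quotmod_scale scale1r. Qed.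

Lemma pi_quotmodD : {morph \pi_quotmod : x y / x + y}.
Proof. exact: (raddfD \pi_quotmod). Qed.

Lemma quotmod_scaleDr : right_distributive quotmod_scale +%R.
Proof.
move=> a x y; rewrite -[x]reprK -[y]reprK -pi_quotmodD -!pi_quotmod_scale.
by rewrite scalerDr pi_quotmodD.
Qed.

Lemma quotmod_scaleDl x : {morph quotmod_scale^~ x : a b / a + b}.
Proof.
by move=> a b; rewrite -[x]reprK -!pi_quotmod_scale scalerDl pi_quotmodD.
Qed.

HB.instance Definition _ := GRing.Zmodule_isLmodule.Build R quotmod
  quotmod_scaleA quotmod_scale1 quotmod_scaleDr quotmod_scaleDl.

End SubmoduleQuotient.

(* Hom_R(U, V), with its pointwise R-module structure. *)
Section HomModule.
Variables (R : comNzRingType) (U V : lmodType R).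

Definition linHom := {linear U -> V}.

HB.instance Definition _ := gen_eqMixin linHom.
HB.instance Definition _ := gen_choiceMixin linHom.

Lemma hom_ext (f g : linHom) : f =1 g -> f = g.
Proof.
case: f g => [f [[fD] [fZ]]] [g [[gD] [gZ]]] /= /funext fg; subst g.
by rewrite (Prop_irrelevance fD gD) (Prop_irrelevance fZ gZ).
Qed.

Definition hom0 : linHom := \0 : U -> V.
Definition hom_opp (f : linHom) : linHom := \- f.
Definition hom_add (f g : linHom) : linHom := f \+ g.
Definition hom_scale (a : R) (f : linHom) : linHom := a \*: f.

Lemma hom_addA : associative hom_add.
Proof. by move=> f g h; apply: hom_ext => x; exact: addrA. Qed.

Lemma hom_addC : commutative hom_add.
Proof. by move=> f g; apply: hom_ext => x; exact: addrC. Qed.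

Lemma hom_add0 : left_id hom0 hom_add.
Proof. by move=> f; apply: hom_ext => x; exact: add0r. Qed.

Lemma hom_addN : left_inverse hom0 hom_opp hom_add.
Proof. by move=> f; apply: hom_ext => x; exact: addNr. Qed.

HB.instance Definition _ := GRing.isZmodule.Build linHom
  hom_addA hom_addC hom_add0 hom_addN.

Lemma hom_scaleA a b f : hom_scale a (hom_scale b f) = hom_scale (a * b) f.
Proof. by apply: hom_ext => x; exact: scalerA. Qed.

Lemma hom_scale1 : left_id 1 hom_scale.
Proof. by move=> f; apply: hom_ext => x; exact: scale1r. Qed.

Lemma hom_scaleDr : right_distributive hom_scale +%R.
Proof. by move=> a f g; apply: hom_ext => x; exact: scalerDr. Qed.

Lemma hom_scaleDl f : {morph hom_scale^~ f : a b / a + b}.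
Proof. by move=> a b; apply: hom_ext => x; exact: scalerDl. Qed.

HB.instance Definition _ := GRing.Zmodule_isLmodule.Build R linHom
  hom_scaleA hom_scale1 hom_scaleDr hom_scaleDl.

End HomModule.

Section KernelImage.
Variables (R : comNzRingType) (U V : lmodType R) (f : {linear U -> V}).

Definition ker_pred : {pred U} := [pred x | f x == 0].

Lemma ker_closed : submod_closed ker_pred.
Proof.
split=> [|a x y]; rewrite !inE ?linear0 // => /eqP fx /eqP fy.
by rewrite linearP fx fy scaler0 addr0.
Qed.

Definition kermod : submod U := Submod ker_closed.

Definition im_pred : {pred V} := [pred y | `[< exists x, f x = y >]].

Lemma im_closed : submod_closed im_pred.
Proof.
split=> [|a _ _ /asboolP[x <-] /asboolP[y <-]]; apply/asboolP.
  by exists 0; rewrite linear0.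
by exists (a *: x + y); rewrite linearP.
Qed.

Definition immod : submod V := Submod im_closed.

End KernelImage.

Section ZeroSubmodule.
Variables (R : comNzRingType) (V : lmodType R).

Lemma zero_closed : submod_closed (pred1 0 : {pred V}).
Proof.
by split=> [|a x y]; rewrite !inE // => /eqP -> /eqP ->; rewrite scaler0 addr0.
Qed.

Definition zero_submod : submod V := Submod zero_closed.

End ZeroSubmodule.

(* For submodules Z and B of V, the submodule Z `&` B of Z. *)
Section Restriction.
Variables (R : comNzRingType) (V : lmodType R) (Z B : submod V).

Definition restr_pred : {pred submodType Z} := [pred z | val z \in submod_pred B].

Lemma restr_closed : submod_closed restr_pred.
Proof.
have [B0 Blin] := submod_predP B.
by split=> [|a x y]; rewrite !inE ?linear0 // => Bx By; rewrite linearP Blin.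
Qed.

Definition restr : submod (submodType Z) := Submod restr_closed.

End Restriction.

Section Ext.
Variable R : comNzRingType.

(* The canonical surjection onto M from the free module on the set M. *)
Section Augmentation.
Variable M : lmodType R.

Definition aug : {freeg M / R} -> M := fglift id.

Lemma aug_zmod_morphism : zmod_morphism aug.
Proof. exact: lift_is_additive. Qed.

Lemma aug_scalable : scalable aug.
Proof.
have augD : {morph aug : D E / D + E}.
  pose H := GRing.isZmodMorphism.Build _ _ aug aug_zmod_morphism.
  pose aug' : {additive {freeg M / R} -> M} := HB.pack aug H.
  exact: (raddfD aug').
have aug0 : aug 0 = 0.
  by have := aug_zmod_morphism 0 0; rewrite !subrr.
have augU c x : aug << c *g x >> = c *: x by exact: liftU.
have augS (s : seq M) (F : M -> R) :
    aug (\sum_(x <- s) << F x *g x >>) = \sum_(x <- s) F x *: x.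
  by rewrite (big_morph aug augD aug0); apply: eq_bigr => x _.
have augE D : aug D = \sum_(x <- dom D) coeff x D *: x.
  by rewrite -augS freeg_sumE.
move=> c D; rewrite [c *: D]/(fgscale c D) augS augE scaler_sumr.
by apply: eq_bigr => x _; rewrite scalerA.
Qed.

HB.instance Definition _ :=
  GRing.isZmodMorphism.Build {freeg M / R} M aug aug_zmod_morphism.
HB.instance Definition _ :=
  GRing.isScalable.Build R {freeg M / R} M *:%R aug aug_scalable.

End Augmentation.

(* The canonical free resolution
     ... -> free_res M 1 -> free_res M 0 -> M -> 0
   of M: free_res M n is the free module on the set syz M n, and syz M n.+1 is
   the kernel of the surjection free_res M n -> syz M n. *)
Fixpoint syz (M : lmodType R) (n : nat) : lmodType R :=
  if n is n'.+1 then submodType (kermod (@aug (syz M n'))) else M.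

Definition free_res (M : lmodType R) (n : nat) : lmodType R :=
  {freeg (syz M n) / R}.

Definition res_diff (M : lmodType R) (n : nat) :
    {linear free_res M n.+1 -> free_res M n} :=
  (val : submodType (kermod (@aug (syz M n))) -> free_res M n) \o
  @aug (syz M n.+1).

Section Cohomology.
Variables (M N : lmodType R).

Definition cochain (n : nat) : lmodType R := linHom (free_res M n) N.

Definition codiff (n : nat) (f : cochain n) : cochain n.+1 :=
  (f \o res_diff M n : {linear free_res M n.+1 -> N}).

Lemma codiff_linear n : linear (@codiff n).
Proof. by move=> a f g; apply: hom_ext. Qed.

HB.instance Definition _ n := GRing.isLinear.Build R (cochain n)
  (cochain n.+1) *:%R (@codiff n) (@codiff_linear n).

Definition cocycles (n : nat) : submod (cochain n) := kermod (@codiff n).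

Definition coboundaries (n : nat) : submod (cochain n) :=
  if n is n'.+1 then immod (@codiff n') else zero_submod (cochain 0).

(* Ext^n_R(M, N), the n-th cohomology module of Hom_R(free_res M, N). *)
Definition Ext (n : nat) : lmodType R :=
  quotmod (restr (cocycles n) (coboundaries n)).

End Cohomology.
End Ext.

Section FractionModule.
Variable R : idomainType.

(* The fraction field of R, as an R-module. *)
Definition fracmod := {fraction R}.

HB.instance Definition _ := GRing.Zmodule.on fracmod.

Definition fracmod_scale (a : R) (x : fracmod) : fracmod :=
  @FracField.tofrac R a * (x : {fraction R}).

Lemma fracmod_scaleA a b x :
  fracmod_scale a (fracmod_scale b x) = fracmod_scale (a * b) x.
Proof. by rewrite /fracmod_scale tofracM mulrA. Qed.

Lemma fracmod_scale1 : left_id 1 fracmod_scale.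
Proof. by move=> x; rewrite /fracmod_scale tofrac1 mul1r. Qed.

Lemma fracmod_scaleDr : right_distributive fracmod_scale +%R.
Proof. by move=> a x y; exact: mulrDr. Qed.

Lemma fracmod_scaleDl x : {morph fracmod_scale^~ x : a b / a + b}.
Proof. by move=> a b; rewrite /fracmod_scale tofracD mulrDl. Qed.

HB.instance Definition _ := GRing.Zmodule_isLmodule.Build R fracmod
  fracmod_scaleA fracmod_scale1 fracmod_scaleDr fracmod_scaleDl.

End FractionModule.

Definition weakly_cotorsion (R : idomainType) (X : lmodType R) : Prop :=
  forall x : Ext (fracmod R) X 1, x = 0.

Section FiniteGeneration.
Variable R : comNzRingType.

Definition in_span (V : lmodType R) (s : seq V) (x : V) : Prop :=
  exists c : 'I_(size s) -> R, x = \sum_(i < size s) c i *: s`_i.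

Definition finitely_generated (V : lmodType R) : Prop :=
  exists s : seq V, forall x, in_span s x.

(* Ideals are the submodules of the regular module R^o. *)
Definition noetherian : Prop :=
  forall I : {pred R^o}, submod_closed I ->
    exists s : seq R^o, forall x, x \in I <-> in_span s x.

End FiniteGeneration.

Section LocalRing.
Variable R : comNzRingType.

(* [idealr_closed] is the library predicate of *proper* ideals. *)
Definition maximal_ideal (m : {pred R}) : Prop :=
  idealr_closed m /\
  forall J : {pred R}, idealr_closed J -> {subset m <= J} -> J =i m.

Definition local_ring (m : {pred R}) : Prop :=
  maximal_ideal m /\ forall m' : {pred R}, maximal_ideal m' -> m' =i m.

(* x is in I * J: a finite sum of products of elements of I and of J. *)
Definition ideal_mul (I J : {pred R}) : {pred R} :=
  [pred x | `[< exists s : seq (R * R),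
    (forall p, p \in s -> p.1 \in I /\ p.2 \in J) /\
    x = \sum_(p <- s) p.1 * p.2 >]].

Definition ideal_pow (I : {pred R}) (n : nat) : {pred R} :=
  iter n (ideal_mul I) predT.

(* The canonical map from R to the inverse limit of the R / m^n is bijective;
   a point of the limit is given by representatives u n in R of its components
   in R / m^n. *)
Definition adically_complete (m : {pred R}) : Prop :=
  forall u : nat -> R,
    (forall n, u n.+1 - u n \in ideal_pow m n) ->
    exists! y : R, forall n, y - u n \in ideal_pow m n.

End LocalRing.

(* Main.v *)
(* Fix b <> 0 in m (if m = 0, then R is a field and Q is free of rank 1).  Call V
   derived b-complete if w |-> (w n - b w (n+1)) is bijective on sequences in V;
   the inverse sums the series w n = y n + b y (n+1) + b^2 y (n+2) + ....
   Limits in the m-adic topology show that R has this property, hence so has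
   every finitely generated module, hence Hom(F, N) for every F (pointwise), and
   the property passes to kernels, images and quotients, so to Ext(M, N).
   If b is invertible on V, as on Q, take a free cover F -> V with kernel K and
   a lift s : F -> F of division by b.  A linear f : K -> X, with X derived
   b-complete, extends to F by D |-> w 0, where w is the solution for
   y n = f (s^n D - b s^(n+1) D): on K the series telescopes to f. *)
Require Import Defs.
From HB Require Import structures.
From mathcomp Require Import all_boot all_algebra.
From mathcomp Require Import generic_quotient ring_quotient fraction.
From mathcomp Require Import boolp freeg.

Set Implicit Arguments.
Unset Strict Implicit.
Unset Printing Implicit Defensive.

Import GRing.Theory.
Local Open Scope ring_scope.
Local Open Scope quotient_scope.

(** * Linear maps, free modules and quotients *)

Section BuildLinear.
Variables (R : comNzRingType) (U V : lmodType R) (f : U -> V).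
Hypothesis f_lin : linear f.

Definition linear_of : {linear U -> V} :=
  HB.pack f (GRing.isLinear.Build R U V *:%R f f_lin).

End BuildLinear.

Section FreeModule.
Variables (R : comNzRingType) (K : choiceType) (V : lmodType R).

Lemma freegU_scale (c : R) (x : K) :
  << c *g x >> = c *: << x >> :> {freeg K / R}.
Proof.
by rewrite /GRing.scale /= /fgscale domU1 big_seq1 coeffU eqxx !mulr1.
Qed.

Lemma freeg_linearE (g : {linear {freeg K / R} -> V}) (D : {freeg K / R}) :
  g D = \sum_(x <- dom D) coeff x D *: g << x >>.
Proof.
rewrite -{1}[D]freeg_sumE linear_sum; apply: eq_bigr => x _.
by rewrite freegU_scale linearZ.
Qed.

(** Universal property of the free module; it will provide the lift of division by [b]. *)
Lemma freeg_lift (h : K -> V) :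
  exists g : {linear {freeg K / R} -> V}, forall x, g << x >> = h x.
Proof.
have h0 : fglift h (0 : {freeg K / R}) = 0.
  by have := lift_is_additive h 0 0; rewrite !subrr.
have hD : {morph fglift h : D E / D + E}.
  move=> D E; have := lift_is_additive h D (0 - E).
  rewrite opprB subr0 => ->; rewrite (lift_is_additive h 0 E) h0.
  by rewrite opprB subr0.
have hS (I : Type) (s : seq I) (c : I -> R) (k : I -> K) :
    fglift h (\sum_(i <- s) << c i *g k i >>) = \sum_(i <- s) c i *: h (k i).
  by rewrite (big_morph _ hD h0); apply: eq_bigr => i _; exact: liftU.
have h_lin : linear (fglift h).
  move=> c D E; rewrite hD; congr (_ + _).
  rewrite -{2}[D]freeg_sumE [c *: D]/(fgscale c D) !hS scaler_sumr.
  by apply: eq_bigr => x _; rewrite scalerA.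
by exists (linear_of h_lin) => x; rewrite /= liftU scale1r.
Qed.

End FreeModule.

Lemma pi_quotmodZ (R : comNzRingType) (V : lmodType R) (S : submod V) :
  scalable (\pi_(quotmod S) : V -> quotmod S).
Proof. exact: pi_quotmod_scale. Qed.

Lemma augU (R : comNzRingType) (V : lmodType R) (x : V) :
  aug (<< x >> : {freeg V / R}) = x.
Proof. by rewrite /aug liftU scale1r. Qed.

(** * Derived completeness and its permanence *)

Section DerivedComplete.
Variables (R : comNzRingType) (b : R).

(* [w] is the family of tails [w n = y n + b y (n+1) + b^2 y (n+2) + ...]. *)
Definition tails (V : lmodType R) (y w : nat -> V) : Prop :=
  forall n, w n = y n + b *: w n.+1.

(** Relative to a predicate, so that kernels, images and spans are treated inside [V], where
    uniqueness is available. *)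
Definition has_tails (V : lmodType R) (S : V -> Prop) : Prop :=
  forall y : nat -> V, (forall n, S (y n)) ->
    exists2 w, forall n, S (w n) & tails y w.

(** Such a [w] amounts to a linear map from R[1/b] to [V], with [w n] the image of b^-n. *)
Definition tails_unique (V : lmodType R) : Prop :=
  forall w : nat -> V, (forall n, w n = b *: w n.+1) -> forall n, w n = 0.

(* Derived b-completeness: Hom(R[1/b], V) = Ext^1(R[1/b], V) = 0. *)
Definition derived_complete (V : lmodType R) : Prop :=
  has_tails (fun _ : V => True) /\ tails_unique V.

Lemma tails_inj (V : lmodType R) (y w w' : nat -> V) :
  tails_unique V -> tails y w -> tails y w' -> w =1 w'.
Proof.
move=> uV yw yw' n; apply/eqP; rewrite -subr_eq0; apply/eqP.
apply: (uV (fun n => w n - w' n)) => {}n.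
by rewrite yw yw' opprD addrACA subrr add0r scalerBr.
Qed.

Lemma tails_linear (U V : lmodType R) (f : {linear U -> V}) (y w : nat -> U) :
  tails y w -> tails (f \o y) (f \o w).
Proof. by move=> yw n /=; rewrite yw linearD linearZ. Qed.

(** Tails are found pointwise; uniqueness in [V] forces them to depend linearly on the argument. *)
Lemma derived_complete_hom (U V : lmodType R) :
  derived_complete V -> derived_complete (linHom U V).
Proof.
move=> [eV uV]; split=> [y _|w ww n]; last first.
  apply: hom_ext => x; apply: (uV (fun n => w n x)) => {}n.
  by rewrite {1}ww.
have /choice[W Wy] x : exists w, tails (fun n => y n x) w.
  by have [//|w _ yw] := eV (fun n => y n x); exists w.
have Wlin n : linear (W^~ n).
  move=> a x x'; apply: (tails_inj uV (Wy _) (w' := fun n => _)) => {}n.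
  rewrite linearP Wy (Wy x') !scalerDr addrACA; congr (_ + (_ + _)).
  by rewrite !scalerA mulrC.
exists (fun n => linear_of (Wlin n)) => // n.
by apply: hom_ext => x; exact: Wy.
Qed.

(** [f] sends tails of a sequence in the kernel to a solution of the homogeneous recursion, which
    vanishes in [V]. *)
Lemma has_tails_ker (U V : lmodType R) (f : {linear U -> V}) :
  derived_complete U -> tails_unique V -> has_tails (fun x => x \in kermod f).
Proof.
move=> [eU _] uV y yK; have [//|w _ yw] := eU y; exists w => // n.
rewrite inE; apply/eqP; apply: (uV (f \o w)) => {}n.
rewrite (tails_linear f yw) /=; move: (yK n); rewrite inE => /eqP ->.
by rewrite add0r.
Qed.

Lemma has_tails_im (U V : lmodType R) (f : {linear U -> V}) :
  derived_complete U -> has_tails (fun x => x \in immod f).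
Proof.
move=> [eU _] y yI; have /choice[u uy] n : exists x, f x = y n.
  by have /asboolP := yI n.
have [//|w _ uw] := eU u; exists (f \o w) => n.
  by apply/asboolP; exists (w n).
by rewrite (tails_linear f uw) /= uy.
Qed.

Lemma has_tails_zero (V : lmodType R) :
  has_tails (fun x => x \in zero_submod V).
Proof.
move=> y y0; exists (fun=> 0) => n; first by rewrite inE.
by have := y0 n; rewrite inE => /eqP ->; rewrite scaler0 addr0.
Qed.

Lemma derived_complete_subquotient (V : lmodType R) (Z B : submod V) :
    tails_unique V -> has_tails (fun x => x \in Z) ->
    has_tails (fun x => x \in B) ->
  derived_complete (quotmod (restr Z B)).
Proof.
move=> uV eZ eB; split=> [y _|w ww n].
  have [|w wZ yw] := eZ (fun n => val (repr (y n))).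
    by move=> n; exact: valP.
  exists (fun n => \pi_(quotmod (restr Z B)) (SubmodType (wZ n))) => // n.
  have -> : y n = \pi_(quotmod (restr Z B)) (repr (y n)) by rewrite reprK.
  rewrite -pi_quotmodZ -pi_quotmodD; congr (\pi_ _ _).
  by apply: val_inj; rewrite /= yw.
(* The representatives solve the recursion up to errors in [B]. These errors have tails [t] in [B],
   and uniqueness in [V] identifies [z] with [t]. *)
pose z k := repr (w k).
have [k|t tB zt] := eB (fun k => val (z k) - b *: val (z k.+1)).
  have /eqP : \pi_(quotmod (restr Z B)) (z k)
      = \pi_(quotmod (restr Z B)) (b *: z k.+1).
    by rewrite pi_quotmodZ !reprK ww.
  by rewrite -Quotient.idealrBE.
have zB : val (z n) \in B.
  suff -> : val (z n) = t n by [].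
  by apply: (tails_inj uV (w := val \o z) _ zt) => k /=; rewrite subrK.
rewrite -[w n]reprK -/(z n) -[RHS](raddf0 (\pi_(quotmod (restr Z B)))).
by apply/eqP; rewrite -Quotient.idealrBE subr0.
Qed.

Lemma derived_complete_Ext (M N : lmodType R) n :
  derived_complete N -> derived_complete (Ext M N n).
Proof.
move=> cN; have cC k := @derived_complete_hom (free_res M k) N cN.
apply: derived_complete_subquotient; first exact: (cC n).2.
  exact: has_tails_ker (cC _) (cC _).2.
case: n => [|n].
  exact: has_tails_zero.
exact: has_tails_im (cC n).
Qed.

(** * Spans and finitely generated modules *)

Lemma in_span_nil (V : lmodType R) (x : V) : in_span [::] x <-> x = 0.
Proof.
split=> [[c ->]|->]; first by rewrite big_ord0.
by exists (fun=> 0); rewrite big_ord0.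
Qed.

Lemma in_span_cons (V : lmodType R) (s : seq V) (v x : V) :
  in_span (v :: s) x <-> exists r, in_span s (x - r *: v).
Proof.
split=> [[c ->]|[r [c xE]]].
  exists (c ord0); exists (fun i => c (fintype.lift ord0 i)).
  by rewrite big_ord_recl /= addrC addKr.
exists (fun i => oapp c r (unlift ord0 i)).
rewrite big_ord_recl /= unlift_none /=.
under eq_bigr do rewrite liftK /=.
by rewrite -xE addrC subrK.
Qed.

Lemma in_span_linear (V : lmodType R) (s : seq V) a (x y : V) :
  in_span s x -> in_span s y -> in_span s (a *: x + y).
Proof.
move=> [c ->] [d ->]; exists (fun i => a * c i + d i).
rewrite scaler_sumr -big_split; apply: eq_bigr => i _ /=.
by rewrite scalerDl scalerA.
Qed.

Lemma in_span0 (V : lmodType R) (s : seq V) : in_span s 0.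
Proof. by exists (fun=> 0); rewrite big1 // => i _; rewrite scale0r. Qed.

Hypothesis cR : derived_complete R^o.

Lemma has_tails_span (V : lmodType R) (s : seq V) : has_tails (in_span s).
Proof.
move=> y /choice[c yE].
have /choice[W Wc] i : exists w : nat -> R^o, tails (fun n => c n i : R^o) w.
  by have [//|w _ cw] := cR.1 (fun n => c n i : R^o); exists w.
exists (fun n => \sum_(i < size s) W i n *: s`_i) => n; first by exists (W^~ n).
rewrite yE scaler_sumr -big_split; apply: eq_bigr => i _ /=.
by rewrite Wc scalerDl scalerA.
Qed.

Hypothesis noethR : noetherian R.

(* Induction on the generators: modulo the first ones, the coefficient of the
   last one solves the homogeneous recursion up to an error in a colon ideal I,
   and has_tails I moves that coefficient itself into I. *)
Lemma tails_unique_span (V : lmodType R) (s : seq V) (w : nat -> V) :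
    (forall n, in_span s (w n)) -> (forall n, w n = b *: w n.+1) ->
  forall n, w n = 0.
Proof.
elim: s => [|v s IHs] w_s ww; first by move=> n; apply/in_span_nil.
apply: IHs => // n.
have /choice[r rE] k : exists a, in_span s (w k - a *: v).
  exact/in_span_cons.
pose I : {pred R^o} := [pred a | `[< in_span s (a *: v) >]].
have Ilin : submod_closed I.
  split=> [|a x y /asboolP sx /asboolP sy]; apply/asboolP.
    by rewrite scale0r; exact: in_span0.
  by rewrite scalerDl -scalerA; exact: in_span_linear.
have [g Ig] := noethR Ilin.
have [k|t tg rt] := @has_tails_span R^o g (fun k => (r k - b * r k.+1 : R^o)).
  apply/Ig/asboolP; rewrite scalerBl -scalerA.
  have -> : r k *: v - b *: (r k.+1 *: v)
      = (-1) *: (w k - r k *: v) + (b *: (w k.+1 - r k.+1 *: v) + 0).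
    by rewrite addr0 scaleN1r opprB scalerBr -ww addrA subrK.
  by apply: in_span_linear => //; apply: in_span_linear => //; exact: in_span0.
have rE' : r n = t n.
  apply: (tails_inj cR.2 (w := (r : nat -> R^o)) _ rt) => k /=.
  by rewrite /GRing.scale /= subrK.
have /Ig/asboolP sn := tg n.
have := in_span_linear 1 (rE n) sn.
by rewrite scale1r rE' subrK.
Qed.

Lemma derived_complete_fg (N : lmodType R) :
  finitely_generated N -> derived_complete N.
Proof.
move=> [s sN]; split=> [y _|w ww n].
  by have [w _ yw] := has_tails_span (fun n => sN (y n)); exists w.
by apply: (tails_unique_span (s := s)).
Qed.

End DerivedComplete.

(** * From adic to derived completeness *)

Section AdicCompleteness.
Variables (R : comNzRingType) (m : {pred R}).
Hypothesis complR : adically_complete m.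

Lemma ideal_pow0 n : 0 \in ideal_pow m n.
Proof. by case: n => [//|n]; apply/asboolP; exists [::]; rewrite big_nil. Qed.

Lemma ideal_powMl b x n :
  b \in m -> x \in ideal_pow m n -> b * x \in ideal_pow m n.+1.
Proof.
move=> bm xmn; apply/asboolP; exists [:: (b, x)]; rewrite big_seq1.
by split=> // p; rewrite inE => /eqP ->.
Qed.

Lemma ideal_powX b x n : b \in m -> b ^+ n * x \in ideal_pow m n.
Proof.
by move=> bm; elim: n => // n IHn; rewrite exprS -mulrA ideal_powMl.
Qed.

Lemma adic_lim_unique (u : nat -> R) (x y : R) :
    (forall n, u n.+1 - u n \in ideal_pow m n) ->
    (forall n, x - u n \in ideal_pow m n) ->
    (forall n, y - u n \in ideal_pow m n) -> x = y.
Proof. by move=> /complR[z [_ zU]] /zU <- /zU <-. Qed.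

Lemma adic_derived_complete b : b \in m -> derived_complete b R^o.
Proof.
move=> bm; split=> [y _|w ww n]; last first.
  (* Since w n = b^k w (n+k) lies in m^k for every k, both [w n] and 0 are limits of the zero
     sequence. *)
  apply: (adic_lim_unique (u := fun=> 0)) => k; rewrite subr0 ?ideal_pow0 //.
  elim: k n => // k IHk n; rewrite ww; exact: ideal_powMl.
(* Partial sums of y i + b y (i+1) + ...; their limit will be [w i]. *)
pose u i n := \sum_(k < n) b ^+ k * y (i + k)%N.
have uS i n : u i n.+1 = y i + b * u i.+1 n.
  rewrite /u big_ord_recl expr0 mul1r addn0 mulr_sumr; congr (_ + _).
  by apply: eq_bigr => k _; rewrite exprS mulrA addSnnS.
have u_cauchy i n : u i n.+1 - u i n \in ideal_pow m n.
  by rewrite {1}/u big_ord_recr addrC /= addKr ideal_powX.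
have /choice[w wu] i : exists z, forall n, z - u i n \in ideal_pow m n.
  by have [z [zu _]] := complR (u_cauchy i); exists z.
(* By [uS], y i + b w (i+1) is also a limit of [u i]; index 0 is trivial because m^0 = R. *)
exists w => // i; apply: (adic_lim_unique (u_cauchy i)) => // -[//|n].
rewrite uS opprD addrACA subrr add0r -mulrBr.
exact: ideal_powMl.
Qed.

End AdicCompleteness.

(** * Vanishing criteria for the first Ext module *)

Section Ext1Vanishing.
Variables (R : comNzRingType) (V X : lmodType R).
Local Notation K := (submodType (kermod (@aug R V))).

(** A 1-cocycle kills the kernel of [aug] on the free module over [K], so it factors through a
    linear map on [K]; extending that map to the free module over [V] exhibits the cocycle as a
    coboundary. *)
Lemma Ext1_eq0 :
    (forall f : {linear K -> X}, exists g : {linear {freeg V / R} -> X},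
      forall k : K, g (val k) = f k) ->
  forall x : Ext V X 1, x = 0.
Proof.
move=> ext x; pose z := repr x; pose phi : {linear {freeg K / R} -> X} := val z.
have phi0 D : aug D = 0 -> phi D = 0.
  move=> D0; have Dker : D \in kermod (@aug R K) by rewrite inE; apply/eqP.
  have : codiff (val z) = 0 by have := valP z; rewrite inE => /eqP.
  move=> /(congr1 (fun h : linHom _ _ => h << SubmodType Dker >>)) /=.
  by rewrite /= augU.
have f_lin : linear (fun k : K => phi << k >>).
  move=> a k k'; apply/eqP; rewrite -linearP -subr_eq0 -linearB; apply/eqP.
  by apply: phi0; rewrite linearB linearP /= !augU subrr.
have [g gE] := ext (linear_of f_lin).
rewrite -[x]reprK -/z -[RHS](raddf0 (\pi_(Ext V X 1))).
apply/eqP; rewrite -Quotient.idealrBE subr0; apply/asboolP; exists g.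
apply: hom_ext => D /=; rewrite gE /=.
apply/eqP; rewrite -subr_eq0 -linearB; apply/eqP; apply: phi0.
by rewrite linearB /= augU subrr.
Qed.

(** The section gives a linear projection D - s (aug D) onto [K]; composing with it extends any map
    on [K]. *)
Lemma Ext1_eq0_split (s : {linear V -> {freeg V / R}}) :
  cancel s (@aug R V) -> forall x : Ext V X 1, x = 0.
Proof.
move=> sK; apply: Ext1_eq0 => f.
have pK D : D - s (aug D) \in kermod (@aug R V).
  by rewrite inE linearB /= sK subrr.
pose p D : K := SubmodType (pK D).
have p_lin : linear p.
  move=> a D E; apply: val_inj => /=.
  by rewrite (linearP (@aug R V)) (linearP s) scalerBr opprD addrACA.
exists (f \o linear_of p_lin) => k /=; congr (f _); apply: val_inj => /=.
by have := valP k; rewrite inE => /eqP ->; rewrite linear0 subr0.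
Qed.

Lemma Ext1_eq0_derived_complete (b : R) (beta : {linear V -> V}) :
    (forall v, b *: beta v = v) -> derived_complete b X ->
  forall x : Ext V X 1, x = 0.
Proof.
move=> bK cX; apply: Ext1_eq0 => f.
have [sg sgE] := freeg_lift (fun v : V => << beta v >> : {freeg V / R}).
have aug_sg D : aug (sg D) = beta (aug D).
  pose l : {linear _ -> _} := @aug R V \o sg.
  pose r : {linear _ -> _} := beta \o @aug R V.
  rewrite [LHS](freeg_linearE l) [RHS](freeg_linearE r).
  by apply: eq_bigr => v _ /=; rewrite sgE /= !augU.
have pK D : D - b *: sg D \in kermod (@aug R V).
  by rewrite inE linearB linearZ /= aug_sg bK subrr.
pose p D : K := SubmodType (pK D).
have p_lin : linear p.
  move=> a D E; apply: val_inj => /=.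
  rewrite (linearP sg) scalerBr scalerDr opprD addrACA.
  by rewrite !scalerA [b * a]mulrC.
(* [y n] sends D to f (sg^n D - b sg^(n+1) D). Taking tails in the Hom module makes [w 0] linear. *)
pose y n : linHom {freeg V / R} X :=
  iter n (fun g : linHom _ _ => (g \o sg : {linear _ -> _}))
    (f \o linear_of p_lin).
have [//|w _ yw] := (derived_complete_hom {freeg V / R} cX).1 y.
exists (w 0%N) => k.
(* As [sg] preserves [K], f (sg^n k) is defined and solves the same recursion as [w n k]; uniqueness
   at n = 0 gives the extension property. *)
have sgK n : iter n sg (val k) \in kermod (@aug R V).
  elim: n => [|n]; first exact: valP.
  by rewrite !inE /= aug_sg => /eqP ->; rewrite linear0.
have -> : f k = f (SubmodType (sgK 0%N)) by congr (f _); exact: val_inj.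
apply: (tails_inj cX.2 (y := fun n => y n (val k)) (w := fun n => w n (val k))
  (w' := fun n => f (SubmodType (sgK n)))) => n; first by rewrite {1}yw.
have -> : y n (val k) = f (p (iter n sg (val k))).
  rewrite /y; elim: n (val k) => //= n IHn D.
  by rewrite IHn -iterSr.
rewrite -linearZ -linearD; congr (f _); apply: val_inj => /=.
by rewrite subrK.
Qed.

End Ext1Vanishing.

(** * The fraction field and the case of a field *)

Section FractionFieldExt.
Variable R : idomainType.

Lemma weakly_cotorsion_derived_complete (b : R) (X : lmodType R) :
  b != 0 -> derived_complete b X -> weakly_cotorsion X.
Proof.
move=> b0 cX; pose beta (x : fracmod R) : fracmod R := (tofrac b)^-1 * x.
have beta_lin : linear beta.
  by move=> a x y; rewrite /beta mulrDr mulrCA.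
apply: (Ext1_eq0_derived_complete (beta := linear_of beta_lin)) cX => v.
by rewrite /= /beta /GRing.scale /= /fracmod_scale mulVKf ?tofrac_eq0.
Qed.

Lemma tofrac_surj : (forall a : R, a != 0 -> a \is a GRing.unit) ->
  forall x : {fraction R}, exists a, tofrac a = x.
Proof.
move=> unitR; elim/quotW => r; exists ((frac r).1 / (frac r).2).
apply/eqP; unlock tofrac; rewrite piE /= FracField.equivfE.
rewrite !numden_Ratio ?oner_eq0 // mul1r mulrVK //.
by rewrite unitR ?denom_ratioP.
Qed.

Lemma weakly_cotorsion_field (X : lmodType R) :
  (forall a : R, a != 0 -> a \is a GRing.unit) -> weakly_cotorsion X.
Proof.
move=> unitR; have /choice[a aE] := tofrac_surj unitR.
(* The fraction field is free on 1 here, since [a] inverts [tofrac]; this section uses only that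
   basis element. *)
pose s (x : fracmod R) : {freeg (fracmod R) / R} :=
  a x *: << (1 : {fraction R}) >>.
have s_lin : linear s.
  move=> c x y; rewrite /s scalerA -scalerDl; congr (_ *: _).
  apply/eqP; rewrite -tofrac_eq aE tofracD tofracM !aE; exact/eqP.
apply: (Ext1_eq0_split (s := linear_of s_lin)) => x /=.
rewrite /s linearZ /= /= augU.
by rewrite /GRing.scale /= /fracmod_scale aE mulr1.
Qed.

Lemma local_field_or_nonzero (m : {pred R}) : local_ring m ->
  (forall a : R, a != 0 -> a \is a GRing.unit) \/ exists2 b, b != 0 & b \in m.
Proof.
move=> [[[m0 _ _] m_max] _].
have [|nb] := pselect (exists2 b, b != 0 & b \in m).
  by right.
have m_eq0 b : b \in m -> b = 0.
  by move=> bm; apply/eqP; apply: contra_notT nb => b0; exists b.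
left=> a; apply: contraNT => a_nunit; apply/eqP/m_eq0.
(* The principal ideal of the non-unit [a] is proper and contains [m], which is zero here;
   maximality then puts [a] in [m]. *)
pose J : {pred R} := [pred x | `[< exists c, x = c * a >]].
have Ja : a \in J by apply/asboolP; exists 1; rewrite mul1r.
rewrite -(m_max J) //; first split.
- by apply/asboolP; exists 0; rewrite mul0r.
- apply: contra a_nunit => /asboolP[c ca].
  by apply/unitrPr; exists c; rewrite mulrC.
- move=> c _ _ /asboolP[d ->] /asboolP[e ->]; apply/asboolP.
  by exists (c * d + e); rewrite mulrDl mulrA.
by move=> b /m_eq0 ->; apply/asboolP; exists 0; rewrite mul0r.
Qed.

End FractionFieldExt.

Theorem mainTheorem12 (R : idomainType) (m : {pred R}) (M N : lmodType R)
    (noethR : noetherian R) (locR : local_ring m)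
    (complR : adically_complete m)
    (fgM : finitely_generated M) (fgN : finitely_generated N) :
  weakly_cotorsion (Ext M N 1).
Proof.
have [unitR|[b b0 bm]] := local_field_or_nonzero locR.
  exact: weakly_cotorsion_field.
apply: (weakly_cotorsion_derived_complete b0); apply: derived_complete_Ext.
by apply: derived_complete_fg => //; exact: adic_derived_complete complR _ bm.
Qed.
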